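(* Let $X$ be a finite set. The Möbius function of the poset $\operatorname{Bip}(X)$, evaluated at its minimum and maximum element, is given by $$\mu(\emptyset,X\times X)=(-1)^{|X|}.$$
   Context: A relation $U\subseteq X\times X$ on a finite set $X$ is bipartitional if both $U$ and $(X\times X)\setminus U$ are transitive. $\operatorname{Bip}(X)$ is the set of bipartitional relations on $X$, partially ordered by inclusion; its minimum is $\emptyset$ and its maximum is $X\times X$. $\mu$ denotes the Möbius function of $\operatorname{Bip}(X)$. *)

(* Defs.v *)
From HB Require Import structures.
From mathcomp Require Import all_boot all_order all_algebra.

Set Implicit Arguments.
Unset Strict Implicit.
Unset Printing Implicit Defensive.

Import Order.TTheory GRing.Theory.

Section Mobius.
Local Open Scope order_scope.
Variables (d : Order.disp_t) (T : finPOrderType d).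
Implicit Types x y z : T.

(* The recursion mu(x, x) = 1, mu(x, y) = - \sum_(x <= z < y) mu(x, z) is run
   with a bound n on its depth; #|T| is enough, see mobius_lt.  When x <= y
   fails the sum is empty, so that mu(x, y) = 0. *)
Fixpoint mobius_rec (n : nat) (x y : T) : int :=
  if x == y then 1%R
  else if n is m.+1 then (- \sum_(z : T | (x <= z < y)%O) mobius_rec m x z)%R
  else 0%R.

Definition mobius (x y : T) : int := mobius_rec #|T| x y.

Lemma mobius_rec_stable m n x y :
  (#|[set z | (x <= z < y)%O]| <= m)%N -> (#|[set z | (x <= z < y)%O]| <= n)%N ->
  mobius_rec m x y = mobius_rec n x y.
Proof.
elim: m n y => [|m IHm] [|n] y /= le_m le_n //; case: eqVneq => // _.
- rewrite big1 ?oppr0 // => z xzy.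
  by move: le_m; rewrite leqn0 cards_eq0 => /eqP/setP/(_ z); rewrite !inE xzy.
- rewrite big1 ?oppr0 // => z xzy.
  by move: le_n; rewrite leqn0 cards_eq0 => /eqP/setP/(_ z); rewrite !inE xzy.
congr (- _)%R; apply: eq_bigr => z /andP[xz zy].
have lt_zy : (#|[set t | (x <= t < z)%O]| < #|[set t | (x <= t < y)%O]|)%N.
  apply: proper_card; apply/properP; split.
    by apply/subsetP => t; rewrite !inE => /andP[-> /lt_trans->].
  by exists z; rewrite !inE xz ?zy // ltxx.
by apply: IHm; rewrite -ltnS (leq_trans lt_zy).
Qed.

Lemma mobiusxx x : mobius x x = 1%R.
Proof. by rewrite /mobius; case: #|T| => [|n] /=; rewrite eqxx. Qed.

Lemma mobius_lt x y :
  x < y -> mobius x y = (- \sum_(z : T | (x <= z < y)%O) mobius x z)%R.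
Proof.
move=> xy; rewrite /mobius (@mobius_rec_stable _ #|T|.+1) ?ltnS ?max_card //=.
  by rewrite lt_eqF.
by rewrite (leq_trans (max_card _)).
Qed.

Lemma mobius_nle x y : ~~ (x <= y) -> mobius x y = 0%R.
Proof.
move=> nxy; have neq : (x == y) = false by apply: contraNF nxy => /eqP->.
rewrite /mobius; case: #|T| => [|n] /=; rewrite neq // big1 ?oppr0 // => z.
by case/andP=> xz /ltW zy; rewrite (le_trans xz zy) in nxy.
Qed.

End Mobius.

Section Bipartitional.
Variable X : finType.

Definition transitiveb (U : {set X * X}) : bool :=
  [forall x, forall y, forall z,
    ((x, y) \in U) && ((y, z) \in U) ==> ((x, z) \in U)].

Definition bipartitional (U : {set X * X}) : bool :=
  transitiveb U && transitiveb (~: U).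

Lemma transitiveP (U : {set X * X}) :
  reflect (transitive (fun x y => (x, y) \in U)) (transitiveb U).
Proof.
apply: (iffP forallP) => [tU y x z xy yz | tU x].
  by move/(_ x)/forallP/(_ y)/forallP/(_ z): tU; rewrite xy yz.
by apply/forallP => y; apply/forallP => z; apply/implyP => /andP[]; exact: tU.
Qed.

Fact bipartitional0 : bipartitional set0.
Proof.
by apply/andP; split; apply/transitiveP => y x z; rewrite !inE.
Qed.

Fact bipartitionalT : bipartitional setT.
Proof.
by apply/andP; split; apply/transitiveP => y x z; rewrite !inE.
Qed.

Record Bip := MkBip { bip_rel :> {set X * X}; _ : bipartitional bip_rel }.

HB.instance Definition _ := [isSub for bip_rel].
HB.instance Definition _ := [Finite of Bip by <:].

Definition bip_le (U V : Bip) : bool := bip_rel U \subset bip_rel V.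

Fact bip_le_refl : reflexive bip_le.
Proof. by move=> U; exact: subxx. Qed.

Fact bip_le_anti : antisymmetric bip_le.
Proof. by move=> U V UV; apply/val_inj/eqP; rewrite eqEsubset. Qed.

Fact bip_le_trans : transitive bip_le.
Proof. by move=> V U W; exact: subset_trans. Qed.

HB.instance Definition _ := Order.Le_isPOrder.Build (Order.Disp tt tt) Bip
  bip_le_refl bip_le_anti bip_le_trans.

Definition bip0 : Bip := MkBip bipartitional0.
Definition bipT : Bip := MkBip bipartitionalT.

Lemma bip_leE (U V : Bip) : (U <= V)%O = (bip_rel U \subset bip_rel V).
Proof. by []. Qed.

Fact bip0_le (U : Bip) : (bip0 <= U)%O.
Proof. by rewrite bip_leE sub0set. Qed.

Fact bip_leT (U : Bip) : (U <= bipT)%O.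
Proof. by rewrite bip_leE subsetT. Qed.

HB.instance Definition _ := Order.hasBottom.Build _ Bip bip0_le.
HB.instance Definition _ := Order.hasTop.Build _ Bip bip_leT.

End Bipartitional.

(* Main.v *)
Require Import Defs.
From mathcomp Require Import all_boot all_order all_algebra.

(** A chain [c] of proper nonempty subsets of [X] determines the irreflexive
bipartitional relation [cut_rel c], the union of the products [A * ~A] for [A]
in [c].  For [V <> X * X], [mu(0, V)] is the signed number of chains [c] with
[cut_rel c = V]: summing over the relations below a given [V <> 0, X * X] gives
the signed number of chains of sets [A] with [A * ~A] contained in [V]; a
proper initial segment [C] of the blocks of [V] is comparable with every such
[A], so that adding or removing [C] cancels everything.  Hence [mu(0, X * X)] is
minus the signed number of all chains of proper nonempty subsets, which is the
value [(-1) ^ #|X|] of the Moebius function of the Boolean lattice. *)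

Set Implicit Arguments.
Unset Strict Implicit.
Unset Printing Implicit Defensive.

Import Order.TTheory GRing.Theory.
Local Open Scope ring_scope.

(** Möbius inversion by induction on the rank [m]: below [y] all terms but the one at [y] already
    agree, so they cancel. Making [P] a down-set allows the top to be left out. *)
Lemma eq_lower_sums (I : finType) (V : zmodType) (le : rel I) (m : I -> nat)
    (P : pred I) (f g : I -> V) :
    reflexive le -> (forall x y, le x y -> x != y -> (m x < m y)%N) ->
    (forall x y, le x y -> P y -> P x) ->
    (forall y, P y -> \sum_(x | le x y) f x = \sum_(x | le x y) g x) ->
  forall y, P y -> f y = g y.
Proof.
move=> le_refl m_lt P_down eq_sum y.
have [n] := ubnP (m y); elim: n y => // n IHn y /ltnSE le_yn Py.
have := eq_sum y Py; rewrite !(bigD1 (P := le^~ y) y) //=.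
suff -> : \sum_(x | le x y && (x != y)) f x = \sum_(x | le x y && (x != y)) g x.
  exact: addIr.
apply: eq_bigr => x /andP[le_xy neq_xy]; apply: IHn.
  exact: leq_trans (m_lt x y le_xy neq_xy) le_yn.
exact: P_down le_xy Py.
Qed.

(** Toggling the membership of [x] is a sign-reversing involution on the sets that satisfy [Q]. *)
Lemma signed_card_cone (T : finType) (Q : pred {set T}) (x : T) :
    (forall A, Q (x |: A) = Q (A :\ x)) ->
  \sum_(A | Q A) (-1) ^+ #|A| = 0 :> int.
Proof.
move=> Qx; rewrite (bigID (fun A : {set T} => x \in A)) /=.
rewrite (reindex_onto (fun A => x |: A) (fun A => A :\ x)) /=; last first.
  by move=> A /andP[_ /setD1K].
apply/eqP; rewrite addr_eq0 -sumrN; apply/eqP/eq_big => A.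
  rewrite Qx setU11 andbT; case xA: (x \in A).
    rewrite andbF; apply/negbTE/negP => /andP[_ /eqP/setP/(_ x)].
    by rewrite !inE eqxx xA.
  have xNA : x \notin A by rewrite xA.
  rewrite setU1K // eqxx !andbT; congr (Q _); apply/setP => y.
  by rewrite !inE; case: eqVneq => // ->; rewrite xA.
move=> /andP[_ /eqP eqA].
have xA : x \notin A by rewrite -eqA !inE eqxx.
by rewrite cardsU1 xA exprS mulN1r.
Qed.

(** * Signed counts of chains of subsets *)

Section Chains.
Variable X : finType.
Implicit Types (A B C S : {set X}) (c : {set {set X}}).

Definition set_chain c : bool :=
  [forall A in c, forall B in c, (A \subset B) || (B \subset A)].

Lemma set_chainP c :
  reflect {in c &, forall A B, (A \subset B) || (B \subset A)} (set_chain c).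
Proof.
apply: (iffP forall_inP) => [cc A B Ac Bc | cc A Ac].
  by have /forall_inP := cc A Ac; apply.
by apply/forall_inP => B; apply: cc.
Qed.

Lemma set_chainS c1 c2 : c1 \subset c2 -> set_chain c2 -> set_chain c1.
Proof.
move=> /subsetP sc /set_chainP cc; apply/set_chainP => A B /sc Ac /sc Bc.
exact: cc.
Qed.

Lemma set_chain_cone C c :
    {in c, forall A, (A \subset C) || (C \subset A)} ->
  set_chain (C |: c) = set_chain (c :\ C).
Proof.
move=> compC; apply/idP/idP.
  by apply: set_chainS; rewrite (subset_trans (subsetDl _ _)) ?subsetUr.
move=> /set_chainP cc; apply/set_chainP => A B.
case: (eqVneq A C) => [->|neqAC]; case: (eqVneq B C) => [->|neqBC].
- by rewrite subxx.
- by rewrite !inE (negPf neqBC) /= => _ /compC; rewrite orbC.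
- by rewrite !inE (negPf neqAC) /= => /compC.
rewrite !inE (negPf neqBC) (negPf neqAC) /= => Ac Bc.
by rewrite cc // !inE ?neqAC ?neqBC.
Qed.

(** The order complex of [Q] is a cone with apex [C], so toggling [C] pairs off its chains, the
    empty one included. *)
Lemma signed_chains_cone (Q : pred {set X}) C :
    Q C -> (forall A, Q A -> (A \subset C) || (C \subset A)) ->
  \sum_(c | set_chain c && [forall A in c, Q A]) (-1) ^+ #|c| = 0 :> int.
Proof.
move=> QC compC; apply: (signed_card_cone (x := C)) => c.
have -> : [forall A in C |: c, Q A] = [forall A in c, Q A].
  apply/forall_inP/forall_inP => Qc A; first by move=> Ac; rewrite Qc ?setU1r.
  by case/setU1P => [-> | /Qc].
have -> : [forall A in c :\ C, Q A] = [forall A in c, Q A].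
  apply/forall_inP/forall_inP => Qc A; last by move=> /setD1P[_ /Qc].
  by case: (eqVneq A C) => [-> // | neqAC Ac]; rewrite Qc // !inE neqAC.
case: forall_inP => Qc; rewrite ?andbF // !andbT; apply: set_chain_cone.
by move=> A /Qc/compC.
Qed.

Lemma mem_cover_set_chain c : set_chain c -> c != set0 -> cover c \in c.
Proof.
move=> /set_chainP cc /set0Pn[A0 A0c].
(* A member of maximal cardinality contains every other member, hence is the union. *)
case: (arg_maxnP (fun A => #|A|) A0c) => A Ac maxA.
suff -> : cover c = A by [].
apply/eqP; rewrite eqEsubset (bigcup_sup A) // andbT.
apply/bigcupsP => B Bc; have /orP[sAB | //] := cc A B Ac Bc.
by have /eqP <- : A == B by rewrite eqEcard sAB; apply: maxA.
Qed.

(** Both sides have the same sums over the subsets of any [B], so inversion in the Boolean lattice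
    identifies them. *)
Lemma signed_chains_cover S :
  \sum_(c | set_chain c && (set0 \notin c) && (cover c == S)) (-1) ^+ #|c|
  = (-1) ^+ #|S| :> int.
Proof.
pose f A : int :=
  \sum_(c | set_chain c && (set0 \notin c) && (cover c == A)) (-1) ^+ #|c|.
suff sum_f (B : {set X}) :
    \sum_(A : {set X} | A \subset B) f A
      = \sum_(A : {set X} | A \subset B) (-1) ^+ #|A|.
  apply: (@eq_lower_sums _ _ (fun A B : {set X} => A \subset B)
    (fun A : {set X} => #|A|) predT f (fun A => (-1) ^+ #|A|)) => //.
  by move=> A B sAB neqAB; rewrite proper_card // properEneq neqAB.
(* Sorting by union, the sum runs over all chains of nonempty subsets of [B]. *)
have -> : \sum_(A : {set X} | A \subset B) f A =
    \sum_(c | set_chain c && [forall A in c, (A != set0) && (A \subset B)])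
      (-1) ^+ #|c|.
  rewrite [RHS](partition_big (@cover X) (fun A : {set X} => A \subset B)) /=; last first.
    move=> c /andP[_ /forall_inP cB].
    by apply/bigcupsP => A /cB/andP[].
  apply: eq_bigr => A sAB; apply: eq_bigl => c.
  case: (eqVneq (cover c) A) => [covA|]; rewrite ?andbF // !andbT.
  congr (_ && _); apply/idP/forall_inP => [c0 D Dc | cB].
    rewrite (contraNneq _ c0) => [|<- //].
    by rewrite (subset_trans _ sAB) // -covA bigcup_sup.
  by apply/negP => /cB; rewrite eqxx.
(* Both sums are 1 for empty [B]. Otherwise both vanish: the chains by toggling [B], the subsets by
   toggling [x]. *)
have [-> | [x xB]] := set_0Vmem B.
  rewrite (big_pred1 set0) => [|c]; first rewrite (big_pred1 set0).
  - by rewrite !cards0.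
  - by move=> A; rewrite subset0.
  rewrite /=; apply/andP/eqP => [[_ /forall_inP c0] | ->].
    apply/setP => A; rewrite inE; apply/negP => /c0.
    by rewrite subset0 andNb.
  by split; [apply/set_chainP | apply/forall_inP] => A; rewrite ?inE // => C; rewrite inE.
rewrite (@signed_chains_cone _ B); last 2 first.
- by rewrite subxx andbT; apply/set0Pn; exists x.
- by move=> A /andP[_ ->].
rewrite (@signed_card_cone _ (fun A : {set X} => A \subset B) x) // => A.
by rewrite subUset sub1set xB subDset (setUidPr _) ?sub1set.
Qed.

Definition nontrivial A : bool := (A != set0) && (A != setT).

(** The chains of nonempty sets cancel, with apex [setT]. Those containing [setT] are those with
    union [setT], contributing [(-1) ^+ #|X|]; the others are the chains counted here. *)
Lemma signed_nontrivial_chains : (0 < #|X|)%N ->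
  \sum_(c | set_chain c && [forall A in c, nontrivial A]) (-1) ^+ #|c|
  = - (-1) ^+ #|X| :> int.
Proof.
move=> /card_gt0P[x _].
have nT : [set: X] != set0 by apply/set0Pn; exists x; rewrite inE.
have := @signed_chains_cone (fun A => A != set0) setT nT
  (fun A _ => introT orP (or_introl (subsetT A))).
rewrite (bigID (fun c => setT \in c)) /= => total.
apply/eqP; rewrite -addr_eq0 addrC -cardsT -signed_chains_cover.
rewrite -[X in _ == X]total.
have memT c : (set0 \notin c) = [forall A in c, A != set0].
  apply/idP/forall_inP => [c0 A Ac | nc]; first by apply: contraNneq c0 => <-.
  by apply/negP => /nc; rewrite eqxx.
apply/eqP; congr (_ + _); apply: eq_bigl => c; rewrite ?memT.
  case cc: (set_chain c) => //=; congr (_ && _); apply/eqP/idP => [covT | Tc].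
    rewrite -covT mem_cover_set_chain //; apply: contraNneq nT => c0.
    by rewrite -covT c0 /cover big_set0.
  by apply/eqP; rewrite eqEsubset subsetT (bigcup_sup setT).
rewrite -andbA; congr (_ && _); apply/forall_inP/andP => [nc | [/forall_inP nc nTc] A Ac].
  split; first by apply/forall_inP => A /nc/andP[].
  by apply/negP => /nc/andP[_ /eqP].
by rewrite /nontrivial nc //; apply: contraNneq nTc => <-.
Qed.

(** * Bipartitional relations cut out by chains *)

Definition cut_rel c : {set X * X} := \bigcup_(A in c) setX A (~: A).

Lemma cut_relP c x y :
  reflect (exists2 A, A \in c & (x \in A) && (y \notin A)) ((x, y) \in cut_rel c).
Proof.
by apply: (iffP bigcupP) => -[A Ac]; rewrite ?inE /= => xy; exists A => //;
  rewrite !inE in xy *.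
Qed.

Lemma cut_rel_irrefl c x : (x, x) \notin cut_rel c.
Proof. by apply/cut_relP => -[A _]; rewrite andbN. Qed.

(** If [A] separates [x] from [y] and [B] separates [y] from [z], then [A] lies in [B], which
    separates [x] from [z]. Conversely, a set separating [x] from [z] separates one of the two
    pairs, according to the side of [y]. *)
Lemma bipartitional_cut_rel c : set_chain c -> bipartitional (cut_rel c).
Proof.
move=> /set_chainP cc; apply/andP; split; apply/transitiveP => y x z.
  move=> /cut_relP[A Ac /andP[xA yA]] /cut_relP[B Bc /andP[yB zB]].
  apply/cut_relP; exists B => //; rewrite zB andbT.
  have /orP[/subsetP -> // | /subsetP sBA] := cc A B Ac Bc.
  by rewrite sBA in yA.
rewrite !inE => nxy nyz; apply/cut_relP => -[A Ac /andP[xA zA]].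
have [yA | yA] := boolP (y \in A).
  by case/cut_relP: nyz; exists A => //; rewrite yA.
by case/cut_relP: nxy; exists A => //; rewrite xA.
Qed.

(* Junk value [bip0 X] when [c] is not a chain. *)
Definition cut_bip c : Bip X := insubd (bip0 X) (cut_rel c).

Lemma cut_bipE c : set_chain c -> bip_rel (cut_bip c) = cut_rel c.
Proof. by move=> cc; apply: (insubdK (bip0 X)); apply: bipartitional_cut_rel. Qed.

(* If some pair [(x, y)] is in [V] with [(y, x)] outside [V], the elements that
   strictly precede [y] form a cut; otherwise [V] is symmetric, hence trivial. *)
Lemma bip_cut_exists (V : Bip X) : V != bip0 X -> V != bipT X ->
  exists C, [/\ nontrivial C, setX C (~: C) \subset bip_rel V
    & forall A, setX A (~: A) \subset bip_rel V -> (A \subset C) || (C \subset A)].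
Proof.
case: V => V bV V0 VT /=.
have {}V0 : V != set0 := V0; have {}VT : V != setT := VT.
case/andP: bV => /transitiveP tV /transitiveP tVC.
have cotr y x z : (x, z) \in V -> ((x, y) \in V) || ((y, z) \in V).
  apply: contraTT; rewrite negb_or => /andP[nxy nyz].
  by have := tVC y x z; rewrite !inE; apply.
have [/existsP[x /existsP[y /andP[xy nyx]]] | sym] :=
    boolP [exists x, exists y, ((x, y) \in V) && ((y, x) \notin V)]; last first.
  have {}sym x y : (x, y) \in V -> (y, x) \in V.
    move=> xy; apply: contraNT sym => nyx.
    by apply/existsP; exists x; apply/existsP; exists y; rewrite xy.
  case/set0Pn: V0 => -[x y] xy; case/negP: VT; rewrite eqEsubset subsetT /=.
  have xV u : (x, u) \in V.
    by have /orP[// | /sym] := cotr u x y xy; apply: tV.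
  by apply/subsetP => -[u v] _; apply: (tV x); [apply: sym|].
pose C := [set z | ((z, y) \in V) && ((y, z) \notin V)].
have yC w : w \notin C -> (w, y) \in V -> (y, w) \in V.
  by rewrite inE => /nandP[/negP // | /negbNE].
exists C; split.
- apply/andP; split; first by apply/set0Pn; exists x; rewrite inE xy.
  by apply/eqP/setP => /(_ y); rewrite !inE andbN.
- apply/subsetP => -[z w]; rewrite !inE /= => /andP[/andP[zy nyz] wC].
  have /orP[// | wy] := cotr w z y zy.
  by apply: (tV y) => //; apply: yC; rewrite ?inE.
(* With [w] in [A] outside [C] and [z] in [C] outside [A], the pairs [(w, z)] and [(z, y)] give
   [(w, y)], hence [(y, w)] and then [(y, z)], against the choice of [z]. *)
move=> A /subsetP AV; have [//|/subsetPn[w wA wC]] := boolP (A \subset C).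
apply/subsetP => z zC; rewrite inE in zC; case/andP: zC => zy nyz.
apply: contraNT nyz => zA.
have wz : (w, z) \in V by apply: AV; rewrite !inE wA.
by apply: (tV w) => //; apply: yC => //; apply: (tV z).
Qed.

(** * The Möbius function as a signed count of chains *)

Lemma mobius_bip0_sum (V : Bip X) :
  \sum_(U : Bip X | (U <= V)%O) mobius (bip0 X) U = (V == bip0 X)%:R.
Proof.
rewrite (bigD1 (P := fun U => (U <= V)%O) V) //=.
have [-> | V0] := eqVneq V (bip0 X).
  rewrite mobiusxx big1 ?addr0 // => U /andP[leU0 neU0].
  by case/eqP: neU0; apply/le_anti; rewrite leU0 bip0_le.
rewrite mobius_lt; last by rewrite lt_neqAle eq_sym V0 bip0_le.
apply/eqP; rewrite addrC subr_eq0; apply/eqP/eq_bigl => U.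
by rewrite bip0_le lt_neqAle andbC.
Qed.

Lemma cut_bip_sum (V : Bip X) (Q : pred {set {set X}}) :
    (forall c, Q c -> set_chain c) ->
  \sum_(U : Bip X | (U <= V)%O) \sum_(c | Q c && (cut_bip c == U)) (-1) ^+ #|c|
  = \sum_(c | Q c && (cut_rel c \subset bip_rel V)) (-1) ^+ #|c| :> int.
Proof.
move=> Qc; rewrite [RHS](partition_big cut_bip (fun U => (U <= V)%O)) /=; last first.
  by move=> c /andP[/Qc cc]; rewrite bip_leE cut_bipE.
apply: eq_bigr => U UV; apply: eq_bigl => c.
case: eqP => [cU|]; rewrite ?andbF // !andbT.
case cQ: (Q c) => //=; have /cut_bipE <- := Qc c cQ.
by rewrite cU -bip_leE UV.
Qed.

(** Both sides have the same lower sums. The top must be excluded: there the containment in [V] is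
    vacuous, no cut serves as apex, and for nonempty [X] the chains do not cancel. *)
Lemma mobius_bip_chains (V : Bip X) : V != bipT X ->
  mobius (bip0 X) V =
  \sum_(c | set_chain c && [forall A in c, nontrivial A] && (cut_bip c == V))
    (-1) ^+ #|c|.
Proof.
apply: (@eq_lower_sums _ _ (fun U V => (U <= V)%O) (fun U => #|bip_rel U|)
    (fun V => V != bipT X) _
    (fun V => \sum_(c | set_chain c && [forall A in c, nontrivial A]
      && (cut_bip c == V)) (-1) ^+ #|c|)) => [U | U W UW neUW | U W UW | W WT].
- exact: lexx.
- by rewrite proper_card // properEneq -bip_leE UW andbT.
- by apply: contraNneq => UT; apply/eqP/le_anti; rewrite bip_leT -UT UW.
rewrite mobius_bip0_sum cut_bip_sum => [|c /andP[]//].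
(* Containment of a union is a condition on each member separately, as the cone argument
   requires. *)
rewrite (eq_bigl (fun c => set_chain c && [forall A in c,
    nontrivial A && (setX A (~: A) \subset bip_rel W)])); last first.
  move=> c; rewrite -andbA; congr (_ && _).
  apply/andP/forall_inP => [[/forall_inP nc /bigcupsP sc] A Ac | nc].
    by rewrite nc // sc.
  by split; [apply/forall_inP | apply/bigcupsP] => A /nc/andP[].
(* Below the empty relation only the empty chain survives, as a nontrivial [A] has a nonempty
   [setX A (~: A)]. *)
have [-> | W0] := eqVneq W (bip0 X).
  rewrite (big_pred1 set0) ?cards0 // => c /=.
  apply/andP/eqP => [[_ /forall_inP nc] | ->]; last first.
    by split; [apply/set_chainP | apply/forall_inP] => A; rewrite inE.
  apply/setP => A; rewrite inE; apply/negP => /nc; rewrite subset0.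
  case/andP=> /andP[/set0Pn[x xA] /eqP nT] /eqP AC; case: nT.
  apply/setP => y; rewrite inE; apply/negPn/negP => yA.
  by have := in_set0 (x, y); rewrite -AC !inE xA yA.
have [C [nC CW compC]] := bip_cut_exists W0 WT.
by rewrite (@signed_chains_cone _ C) // ?nC // => A /andP[_ /compC].
Qed.

End Chains.

Theorem corollary9p5 (X : finType) :
  mobius (bip0 X) (bipT X) = ((-1) ^+ #|X|)%R.
Proof.
have [X0 | Xgt0] := posnP #|X|.
  have -> : bipT X = bip0 X.
    apply: val_inj; apply/setP => -[x y].
    by have /card0_eq/(_ x) := X0; rewrite inE.
  by rewrite mobiusxx X0.
have /card_gt0P[x _] := Xgt0.
(* Cut relations are irreflexive, so every chain is counted at some relation below the top. *)
have cutNT (c : {set {set X}}) : set_chain c -> cut_bip c != bipT X.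
  move=> cc; apply: contraNneq (cut_rel_irrefl c x) => cT.
  by rewrite -cut_bipE // cT inE.
have T0 : bip0 X != bipT X.
  by apply/eqP => /(congr1 (@bip_rel X))/setP/(_ (x, x)); rewrite !inE.
rewrite mobius_lt; last by rewrite lt_neqAle T0 bip0_le.
rewrite (eq_bigl (fun U : Bip X => U != bipT X)); last first.
  by move=> U; rewrite bip0_le lt_neqAle bip_leT andbT.
rewrite (eq_bigr _ (@mobius_bip_chains X)) -[RHS]opprK -signed_nontrivial_chains //.
congr (- _); apply/esym; apply: partition_big => c /andP[cc _].
exact: cutNT.
Qed.
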